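(* Let $N\in\mathbb N$ and $\mathfrak L\in\mathbf{StIP}_N$. Then for all $\mathfrak s,\mathfrak t\in\mathbf{StIP}$, $$\big\langle\mathsf{IPC}(\mathfrak L),\mathfrak s\big\rangle\cdot\big\langle\mathsf{IPC}(\mathfrak L),\mathfrak t\big\rangle=\big\langle\mathsf{IPC}(\mathfrak L),\,\mathfrak s\spadesuit\mathfrak t\big\rangle ,$$ i.e. each linear map $\mathsf{IPC}(\mathfrak L):\mathcal H_{\mathrm{int}}\to\mathbb Q$ is a character for the product $\spadesuit$.
   Context: $\mathbb N=\{0,1,2,\dots\}$, $\mathbb N_{\ge1}=\{1,2,\dots\}$, $[n]=\{1,\dots,n\}$, $[0]=\emptyset$. For a finite set $A\subset\mathbb N_{\ge1}$, an interval partition of $A$ is a finite set $\mathcal I$ of non-empty pairwise disjoint sets (blocks) with union $A$, each block being an interval of $\mathbb N_{\ge1}$ (a set of consecutive integers $\{a,a+1,\dots,b\}$). $\mathbf{IP}(A)$ is the set of these ($\mathbf{IP}(\emptyset)=\{\emptyset\}$), $\mathbf{IP}=\bigcup_A\mathbf{IP}(A)$, and $\bigcup\mathcal I$ denotes the ground set of $\mathcal I$. $\mathbf{StIP}_n:=\mathbf{IP}([n])$, $\mathbf{StIP}:=\bigcup_{n}\mathbf{StIP}_n$. Order: for $\mathcal I,\mathcal J\in\mathbf{IP}$, $\mathcal I\le\mathcal J$ means $\bigcup\mathcal I=\bigcup\mathcal J$ and every block of $\mathcal I$ is contained in a block of $\mathcal J$ ($\mathcal I$ refines $\mathcal J$).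 Standardization: for $\mathcal I\in\mathbf{IP}$ with $|\bigcup\mathcal I|=n$, $\mathbf{std}(\mathcal I)\in\mathbf{StIP}_n$ is the image of $\mathcal I$, block by block, under the unique order-preserving bijection $\bigcup\mathcal I\to[n]$. Cliques: for finite $A\subset\mathbb N_{\ge1}$, $\mathbf{cliques}(A)$ is the coarsest interval partition of $A$, i.e. the set of maximal runs of consecutive integers in $A$. For $\mathcal I\in\mathbf{IP}$, $\mathcal I(A):=\{E\cap c\mid E\in\mathcal I,\ c\in\mathbf{cliques}(A)\}\setminus\{\emptyset\}$, an interval partition of $A\cap\bigcup\mathcal I$. Gluing: for $\mathcal I,\mathcal J\in\mathbf{IP}$, let $\sim$ be the smallest equivalence relation on the set of blocks $\mathcal I\cup\mathcal J$ such that $E\sim F$ whenever $E\cap F\neq\emptyset$. Then $\mathcal I\cdot_{\mathrm{glue}}\mathcal J:=\{\bigcup_{X\in[T]_\sim}X\mid T\in\mathcal I\cup\mathcal J\}$. $\mathcal H_{\mathrm{int}}$ is the free $\mathbb Q$-vector space on $\mathbf{StIP}$. For $\mathfrak g\in\mathbf{StIP}$, $\Delta_\spadesuit(\mathfrak g):=\sum_{A\cup A'=\bigcup\mathfrak g}\ \sum_{\mathcal I\in\mathbf{IP}(A),\,\mathcal I'\in\mathbf{IP}(A'),\ \mathcal I\cdot_{\mathrm{glue}}\mathcal I'=\mathfrak g}\mathbf{std}(\mathcal I)\otimes\mathbf{std}(\mathcal I')$ (outer sum over ordered pairs of not necessarily disjoint subsets), and $\spadesuit$ is the bilinear product $\mathfrak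 s\spadesuit\mathfrak t:=\sum_{\mathfrak g\in\mathbf{StIP}}\langle\mathfrak s\otimes\mathfrak t,\Delta_\spadesuit(\mathfrak g)\rangle\,\mathfrak g$, where $\langle\cdot,\cdot\rangle$ is the pairing making basis elements orthonormal (a finite sum). Signature: for $\mathfrak L\in\mathbf{StIP}$, $\mathsf{IPC}(\mathfrak L):\mathcal H_{\mathrm{int}}\to\mathbb Q$ is the linear map with $\langle\mathsf{IPC}(\mathfrak L),\mathfrak s\rangle:=\#\{A\subset\bigcup\mathfrak L\mid\mathbf{std}(\mathfrak L(A))\ge\mathfrak s\}$ for $\mathfrak s\in\mathbf{StIP}$. *)

(* Defs.v *)
From HB Require Import structures.
From mathcomp Require Import all_boot all_order all_algebra finmap zify.
From mathcomp Require Import freeg.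
From mathcomp Require Import boolp classical_sets functions cardinality fsbigop.

Set Implicit Arguments.
Unset Strict Implicit.
Unset Printing Implicit Defensive.

Import GRing.Theory.

Local Open Scope fset_scope.
Local Open Scope ring_scope.

Definition nitv (a b : nat) : {fset nat} := [fset x in index_iota a b.+1].

Lemma mem_nitv a b x : (x \in nitv a b) = (a <= x <= b)%N.
Proof. by rewrite in_fset /= mem_index_iota ltnS. Qed.

Lemma card_nitv1 n : #|` nitv 1 n| = n.
Proof.
rewrite /nitv card_imfset //=.
by rewrite undup_id ?iota_uniq // size_iota; lia.
Qed.

Definition is_nitv (E : {fset nat}) : bool :=
  [exists a : E, exists b : E, E == nitv (val a) (val b)].

Lemma is_nitvP (E : {fset nat}) :
  reflect (E != fset0 /\ forall x y z, x \in E -> y \in E ->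
             (x <= z <= y)%N -> z \in E) (is_nitv E).
Proof.
apply: (iffP existsP) => [[a /existsP[b /eqP Eab]]|[/fset0Pn[x0 x0E] cvx]].
  split; first by apply/fset0Pn; exists (val a); exact: valP.
  by move=> x y z; rewrite Eab !mem_nitv => /andP[? ?] /andP[? ?] /andP[? ?]; lia.
pose a := [arg min_(i < [` x0E] | true) val i].
pose b := [arg max_(i > [` x0E] | true) val i].
have amin (x : E) : (val a <= val x)%N by rewrite /a; case: arg_minnP => // i _; exact.
have bmax (x : E) : (val x <= val b)%N by rewrite /b; case: arg_maxnP => // i _; exact.
exists a; apply/existsP; exists b; apply/eqP/fsetP => x; rewrite mem_nitv.
apply/idP/idP => [xE|]; last by apply: cvx; exact: valP.
by rewrite (amin [` xE]) (bmax [` xE]).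
Qed.

Definition is_ip (I : {fset {fset nat}}) : bool :=
  [&& fset0 \notin I, trivIfset I, [forall E : I, is_nitv (val E)]
    & 0%N \notin fcover I].

Lemma is_ipP (I : {fset {fset nat}}) :
  reflect [/\ forall E, E \in I -> is_nitv E,
              forall E F x, E \in I -> F \in I -> x \in E -> x \in F -> E = F
            & forall E, E \in I -> 0%N \notin E] (is_ip I).
Proof.
apply: (iffP and4P) => [[_ /trivIfsetP tI /forallP vI nI]|[vI tI nI]].
  split=> [E EI|E F x EI FI xE xF|E EI]; first exact: (vI [` EI]).
    apply/eqP; apply: contraT => /(tI _ _ EI FI) /fdisjointP /(_ x xE).
    by rewrite xF.
  by apply: contra nI => E0; apply/bigfcupP; exists E; rewrite ?EI.
split.
- by apply/negP => /vI /is_nitvP[]; rewrite eqxx.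
- apply/trivIfsetP => E F EI FI EF; apply/fdisjointP => x xE.
  by apply: contraNN EF => xF; apply/eqP; exact: tI xE xF.
- by apply/forallP => E; apply: vI; exact: valP.
- by apply/bigfcupP => -[E]; rewrite andbT => /nI /negbTE ->.
Qed.

Record IP := MkIP { blocks :> {fset {fset nat}}; _ : is_ip blocks }.
HB.instance Definition _ := [isSub for blocks].
HB.instance Definition _ := [Choice of IP by <:].

Definition ground (I : IP) : {fset nat} := fcover I.

(* The size n is determined by the ground set: for an interval partition I,
   "ground I = [n] for some n" means "ground I = [n] with n = #|` ground I|". *)
Definition is_std (I : IP) : bool := ground I == nitv 1 #|` ground I|.

Record StIP := MkStIP { stip_val :> IP; _ : is_std stip_val }.
HB.instance Definition _ := [isSub for stip_val].
HB.instance Definition _ := [Choice of StIP by <:].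

Definition StIPn (n : nat) : pred StIP := [pred I : StIP | ground I == nitv 1 n].

Definition refines (I J : IP) : bool :=
  (ground I == ground J)
    && [forall E : blocks I, exists F : blocks J, val E `<=` val F].

Definition IPon (A : {fset nat}) : {fset IP} :=
  [fset I in pmap insub (fpowerset (fpowerset A)) | ground I == A].

Lemma mem_IPon A I : (I \in IPon A) = (ground I == A).
Proof.
rewrite in_fset /= inE andbC.
case: eqP => //= gI; rewrite mem_pmap; apply/mapP; exists (blocks I).
  rewrite fpowersetE; apply/fsubsetP => E EI; rewrite fpowersetE -gI.
  by apply/fsubsetP => x xE; apply/bigfcupP; exists E; rewrite ?EI.
by rewrite -[LHS]valK.
Qed.

(* The order-preserving bijection A -> [#|A|]; see [rank_mono], [rank_image]. *)
Definition rank (A : {fset nat}) (x : nat) : nat :=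
  #|` [fset y in A | (y <= x)%N]|.

Lemma rank_lt (A : {fset nat}) x y :
  y \in A -> (x < y)%N -> (rank A x < rank A y)%N.
Proof.
move=> yA xy; apply: fproper_ltn_card; rewrite fproperE; apply/andP; split.
  apply/fsubsetP => z; rewrite !inE /= => /andP[-> zx].
  exact: leq_trans zx (ltnW xy).
by apply/fsubsetPn; exists y; rewrite !inE yA /= ?leqnn // -ltnNge.
Qed.

Lemma rank_mono (A : {fset nat}) :
  {in A &, {mono rank A : x y / (x <= y)%N}}.
Proof.
move=> x y xA yA; case: (leqP x y) => [|yx].
  by rewrite leq_eqVlt => /orP[/eqP->|/(rank_lt yA)/ltnW ->]; rewrite ?leqnn.
by apply/negbTE; rewrite -ltnNge; exact: rank_lt.
Qed.

Lemma rank_inj (A : {fset nat}) : {in A &, injective (rank A)}.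
Proof.
move=> x y xA yA rxy; apply/eqP; rewrite eqn_leq.
by rewrite -(rank_mono xA yA) -(rank_mono yA xA) rxy leqnn.
Qed.

Lemma rank_image (A : {fset nat}) : rank A @` A = nitv 1 #|` A|.
Proof.
apply/eqP; rewrite eqEfcard card_nitv1 card_in_imfset ?leqnn ?andbT; last exact: rank_inj.
apply/fsubsetP => _ /imfsetP[/= x xA ->]; rewrite mem_nitv; apply/andP; split.
  by rewrite cardfs_gt0; apply/fset0Pn; exists x; rewrite !inE xA /=.
by apply: fsubset_leq_card; apply/fsubsetP => y; rewrite !inE => /andP[].
Qed.

Lemma groundP (I : IP) x :
  reflect (exists2 E, E \in blocks I & x \in E) (x \in ground I).
Proof.
apply: (iffP (bigfcupP _ _ _ _)) => -[E EI xE]; exists E => //.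
  by move: EI; rewrite andbT.
by rewrite EI.
Qed.

Definition std_blocks (I : IP) : {fset {fset nat}} :=
  [fset rank (ground I) @` (E : {fset nat}) | E in blocks I].

Lemma std_is_ip I : is_ip (std_blocks I).
Proof.
have /is_ipP[vI tI nI] := valP I.
have sub E : E \in blocks I -> {subset E <= ground I}.
  by move=> EI x xE; apply/groundP; exists E.
have rg x : x \in ground I -> rank (ground I) x \in nitv 1 #|` ground I|.
  by move=> xI; rewrite -rank_image; apply/imfsetP; exists x.
apply/is_ipP; split.
- move=> _ /imfsetP[/= E EI ->]; have /is_nitvP[/fset0Pn[x xE] cE] := vI _ EI.
  apply/is_nitvP; split.
    by apply/fset0Pn; exists (rank (ground I) x); apply/imfsetP; exists x.
  move=> _ _ z /imfsetP[/= a aE ->] /imfsetP[/= b bE ->] abz.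
  have aI := sub _ EI _ aE; have bI := sub _ EI _ bE.
  have : z \in nitv 1 #|` ground I|.
    by move: (rg _ aI) (rg _ bI) abz; rewrite !mem_nitv; lia.
  rewrite -rank_image => /imfsetP[/= w wI zw]; apply/imfsetP; exists w => //=.
  by apply: (cE a b) => //; move: abz; rewrite zw !rank_mono.
- move=> _ _ z /imfsetP[/= E EI ->] /imfsetP[/= F FI ->].
  move=> /imfsetP[/= a aE ->] /imfsetP[/= b bF /rank_inj ab].
  have {}ab : a = b by apply: ab; [exact: sub aE | exact: sub bF].
  by rewrite (tI E F a) // ab.
- move=> _ /imfsetP[/= E EI ->]; apply/imfsetP => -[/= x /(sub _ EI) /rg].
  by rewrite mem_nitv => /[swap] <-.
Qed.

Lemma ground_std_blocks I : ground (MkIP (std_is_ip I)) = nitv 1 #|` ground I|.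
Proof.
rewrite -rank_image; apply/fsetP => z; apply/groundP/imfsetP => /=.
  move=> [_ /imfsetP[/= E EI ->] /imfsetP[/= x xE ->]].
  by exists x => //; apply/groundP; exists E.
move=> [x /groundP[E EI xE] ->]; exists (rank (ground I) @` E).
  by apply/imfsetP; exists E.
by apply/imfsetP; exists x.
Qed.

Lemma std_is_std I : is_std (MkIP (std_is_ip I)).
Proof. by rewrite /is_std !ground_std_blocks card_nitv1. Qed.

Definition std (I : IP) : StIP := MkStIP (std_is_std I).

Definition cliques (A : {fset nat}) : {fset {fset nat}} :=
  [fset c in fpowerset A | is_nitv c &&
    [forall d : fpowerset A, is_nitv (val d) ==> (c `<=` val d) ==> (c == val d)]].

Lemma cliquesP (A c : {fset nat}) :
  reflect [/\ c `<=` A, is_nitv c & forall d, d `<=` A -> is_nitv d ->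
             c `<=` d -> c = d] (c \in cliques A).
Proof.
rewrite !inE /= fpowersetE.
apply: (iffP and3P) => [[cA vc /forallP mc]|[cA vc mc]]; split=> //.
  move=> d dA vd cd; have dA' : d \in fpowerset A by rewrite fpowersetE.
  by have := mc [` dA']; rewrite /= vd cd /= => /eqP.
apply/forallP => d; apply/implyP => vd; apply/implyP => cd; apply/eqP.
by apply: mc => //; rewrite -fpowersetE; exact: valP.
Qed.

Lemma is_nitvU (c d : {fset nat}) x :
  is_nitv c -> is_nitv d -> x \in c -> x \in d -> is_nitv (c `|` d).
Proof.
move=> /is_nitvP[_ vc] /is_nitvP[_ vd] xc xd; apply/is_nitvP; split.
  by apply/fset0Pn; exists x; rewrite inE xc.
move=> a b z; rewrite !inE => ha hb abz; apply/orP.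
have [zx|xz] := leqP z x.
  by case/orP: ha => [ac|ad]; [left; apply: (vc a x)|right; apply: (vd a x)] => //; lia.
by case/orP: hb => [bc|bd]; [left; apply: (vc x b)|right; apply: (vd x b)] => //; lia.
Qed.

Lemma cliques_disj (A c d : {fset nat}) x :
  c \in cliques A -> d \in cliques A -> x \in c -> x \in d -> c = d.
Proof.
move=> /cliquesP[cA vc mc] /cliquesP[dA vd md] xc xd.
have vcd := is_nitvU vc vd xc xd.
have cdA : c `|` d `<=` A by rewrite fsubUset cA.
by rewrite [LHS](mc _ cdA vcd (fsubsetUl _ _)) -(md _ cdA vcd (fsubsetUr _ _)).
Qed.

(* Every nonempty interval inside A lies in a clique: the partition
   [cliques A] is coarser than any interval partition of A. *)
Lemma cliques_coarsest (A E : {fset nat}) :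
  E `<=` A -> is_nitv E -> exists2 c, c \in cliques A & E `<=` c.
Proof.
move=> EA vE.
have [n] := ubnP (#|` A| - #|` E|); elim: n E EA vE => // n IH E EA vE lt_n.
have [mE|/cliquesP mE] := boolP (E \in cliques A); first by exists E.
have [d [dA vd Ed ne]] : exists d, [/\ d `<=` A, is_nitv d, E `<=` d & E != d].
  apply/not_existsP => h; apply: mE; split=> // d dA vd Ed.
  by apply/eqP; apply: contra_notT (h d).
have lt_d : (#|` E| < #|` d|)%N by apply: fproper_ltn_card; rewrite fproperEneq ne.
have le_d : (#|` d| <= #|` A|)%N by exact: fsubset_leq_card.
have [|c cA dc] := IH d dA vd; first by lia.
by exists c => //; exact: fsubset_trans dc.
Qed.

(* The blocks of I(A). *)
Definition restr_blocks (I : IP) (A : {fset nat}) : {fset {fset nat}} :=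
  [fset (E : {fset nat}) `&` c | E in blocks I, c in cliques A] `\ fset0.

Lemma restr_is_ip I A : is_ip (restr_blocks I A).
Proof.
have /is_ipP[vI tI nI] := valP I.
apply/is_ipP; split.
- move=> X; rewrite in_fsetD1 => /andP[X0 /imfset2P[/= E EI [c cA XE]]].
  apply/is_nitvP; split=> // a b z; rewrite XE !inE.
  have /is_nitvP[_ cE] := vI _ EI; have /cliquesP[_ /is_nitvP[_ cc] _] := cA.
  move=> /andP[aE ac] /andP[bE bc] abz.
  by rewrite (cE a b) //= (cc a b).
- move=> X Y x; rewrite !in_fsetD1 => /andP[_ /imfset2P[/= E EI [c cA ->]]].
  move=> /andP[_ /imfset2P[/= F FI [d dA ->]]]; rewrite !inE.
  by move=> /andP[xE xc] /andP[xF xd]; rewrite (tI E F x) // (cliques_disj cA dA xc).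
- move=> X; rewrite in_fsetD1 => /andP[_ /imfset2P[/= E EI [c cA ->]]].
  by rewrite inE negb_and (nI _ EI).
Qed.

Definition restr (I : IP) (A : {fset nat}) : IP := MkIP (restr_is_ip I A).

Lemma ground_restr I A : ground (restr I A) = A `&` ground I.
Proof.
apply/fsetP => x; rewrite inE; apply/groundP/andP.
  move=> [X]; rewrite /= in_fsetD1 => /andP[_ /imfset2P[/= E EI [c cA ->]]].
  rewrite inE => /andP[xE xc]; split; last by apply/groundP; exists E.
  by move/cliquesP: cA => [/fsubsetP cA _ _]; exact: cA.
move=> [xA /groundP[E EI xE]].
have [||c cA xc] := @cliques_coarsest A [fset x].
- by rewrite fsub1set.
- apply/is_nitvP; split; first by apply/fset0Pn; exists x; rewrite inE.
  by move=> a b z; rewrite !inE => /eqP -> /eqP -> /andP[? ?]; rewrite eqn_leq; lia.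
rewrite fsub1set in xc; exists (E `&` c); last by rewrite inE xE.
rewrite /restr_blocks in_fsetD1; apply/andP; split.
  by apply/fset0Pn; exists x; rewrite inE xE.
by apply/imfset2P; exists E => //; exists c.
Qed.

Definition meets (B : {fset {fset nat}}) : rel B :=
  [rel E F | val E `&` val F != fset0].

(* [connect] is the reflexive-transitive closure; as [meets] is symmetric, this
   is the smallest equivalence relation containing it; see [glue_eqvP]. *)
Definition glue_eqv (B : {fset {fset nat}}) : rel B := connect (@meets B).

Lemma glue_eqvP (B : {fset {fset nat}}) :
  [/\ equivalence_rel (@glue_eqv B), subrel (@meets B) (@glue_eqv B)
    & forall r : rel B, equivalence_rel r -> subrel (@meets B) r ->
        subrel (@glue_eqv B) r].
Proof.
have sym : connect_sym (@meets B).
  by apply: sym_connect_sym => E F; rewrite /meets /= fsetIC.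
split.
- by apply/equivalence_relP; split=> [E|E F EF G]; [exact: connect0|exact: same_connect].
- exact: connect1.
- move=> r /equivalence_relP[rr lr] sub E F /connectP[p pE ->] {F}.
  elim: p E pE => [|F p IH] E /=; first by move=> _; exact: rr.
  by move=> /andP[/sub /lr -> /IH].
Qed.

Definition glue (I J : IP) : {fset {fset nat}} :=
  [fset (\bigcup_(F | glue_eqv T F) val F)%fset
     | T : blocks I `|` blocks J].

Definition H_int := {freeg StIP / rat}.

(* The free vector space on StIP * StIP, i.e. H_int (x) H_int. *)
Definition H_int2 := {freeg (StIP * StIP)%type / rat}.

Definition pairing (K : choiceType) (x y : {freeg K / rat}) : rat :=
  \sum_(k <- dom x) coeff k x * coeff k y.

Definition tensor (s t : StIP) : H_int2 := << (s, t) >>.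

Definition Delta_basis (g : StIP) : H_int2 :=
  \sum_(A <- fpowerset (ground g))
    \sum_(A' <- fpowerset (ground g) | A `|` A' == ground g)
      \sum_(I <- IPon A)
        \sum_(I' <- IPon A' | glue I I' == blocks g)
          tensor (std I) (std I').

(* [\sum_(g \in setT)] is the finitely supported sum; finiteness of the support
   is [spade_finite]. *)
Definition spade_basis (s t : StIP) : H_int :=
  \sum_(g \in [set: StIP]) pairing (tensor s t) (Delta_basis g) *: (<< g >> : H_int).

(* Bilinear extension: [fglift f] is the linear map extending f. *)
Definition spade (x y : H_int) : H_int :=
  fglift (fun s => fglift (fun t => spade_basis s t) y) x.

(* [refines I J] is the order I <= J, so the condition is std (L(A)) >= s. *)
Definition IPC_basis (L s : StIP) : nat :=
  #|` [fset A in fpowerset (ground L) | refines s (std (restr L A))]|.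

Definition IPC (L : StIP) (x : H_int) : rat :=
  fglift (fun s => (IPC_basis L s)%:R : rat^o) x.

(* Character with respect to [spade]: a multiplicative linear functional. *)
Definition is_character (phi : H_int -> rat) : Prop :=
  linear (phi : H_int -> rat^o) /\
  forall x y : H_int, phi (spade x y) = phi x * phi y.

Lemma StIP_exn (I : IP) : reflect (exists n, ground I = nitv 1 n) (is_std I).
Proof.
apply: (iffP eqP) => [->|[n In]]; first by exists #|` ground I|.
by rewrite {2}In card_nitv1.
Qed.

Lemma fglift_linear (R : nzRingType) (K : choiceType) (M : lmodType R) (f : K -> M) :
  linear (fglift f : {freeg K / R} -> M).
Proof.
move=> c x y.
pose F := GRing.isZmodMorphism.Build _ _ (fglift f) (@lift_is_additive R K M f).
pose G : {additive {freeg K / R} -> M} := HB.pack (fglift f) F.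
have GE z : fglift f z = G z by [].
rewrite !GE raddfD; congr (_ + _).
have -> : c *: x = \sum_(z <- dom x) << (c * coeff z x) *g z >> by [].
rewrite raddf_sum -[in RHS](freeg_sumE x) raddf_sum scaler_sumr.
by apply: eq_bigr => z _; rewrite -!GE !liftU scalerA.
Qed.

Lemma IPC_linear (L : StIP) : linear (IPC L : H_int -> rat^o).
Proof. exact: fglift_linear. Qed.

Lemma IPC_basisE (L s : StIP) : IPC L << s >> = (IPC_basis L s)%:R.
Proof. by rewrite /IPC liftU scale1r. Qed.

Lemma spade_basisE (s t : StIP) : spade << s >> << t >> = spade_basis s t.
Proof. by rewrite /spade !liftU !scale1r. Qed.

Lemma pairing_tensor (s t : StIP) (x : H_int2) :
  pairing (tensor s t) x = coeff (s, t) x.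
Proof. by rewrite /pairing domU1 big_seq1 coeffU eqxx !mul1r. Qed.

Lemma spade_finite (s t : StIP) :
  finite_set [set g : StIP | pairing (tensor s t) (Delta_basis g) != 0].
Proof.
pose n := (#|` ground s| + #|` ground t|)%N.
pose S := [fset g : StIP in
  pmap insub (pmap insub (fpowerset (fpowerset (nitv 1 n))) : seq IP)].
apply: (@sub_finite_set _ _ [set` S]); last exact: finite_fset.
move=> g /=; rewrite pairing_tensor => nz.
suff le_n : (#|` ground g| <= n)%N.
  rewrite in_fset /= mem_pmap; apply/mapP; exists (stip_val g); last first.
    by rewrite -[LHS]valK.
  rewrite mem_pmap; apply/mapP; exists (blocks g); last by rewrite -[LHS]valK.
  rewrite fpowersetE; apply/fsubsetP => E EI; rewrite fpowersetE.
  apply/fsubsetP => x xE.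
  have : x \in ground g by apply/groundP; exists E.
  rewrite (eqP (valP g) : ground g = _) !mem_nitv => /andP[-> /=].
  by move=> /leq_trans; apply.
apply: contraNT nz; rewrite -ltnNge => lt_n; apply/eqP.
rewrite /Delta_basis raddf_sum big1_seq //= => A _.
rewrite raddf_sum big1_seq //= => A' /andP[/eqP AA' _].
rewrite raddf_sum big1_seq //= => I; rewrite mem_IPon => /eqP IA.
rewrite raddf_sum big1_seq //= => I' /andP[_]; rewrite mem_IPon => /eqP IA'.
rewrite coeffU mul1r; case: eqP => // -[sE tE]; move: lt_n; rewrite ltnNge => /negP[].
rewrite /n -sE -tE !ground_std_blocks !card_nitv1 IA IA' -AA'.
exact: (leq_card_fsetU A A').1.
Qed.

(* Main.v *)
(* Call I subordinate to K when every block of I lies in a block of K.  As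
   [std] is injective on the interval partitions of a given ground set, and an
   order-convex part of a block is an interval, <IPC(L), s> counts the I
   subordinate to L with std(I) = s.  Ranking in the ground set of K is an
   isomorphism from the poset of interval partitions subordinate to K onto the
   poset of those subordinate to std(K); it preserves standardizations, and it
   preserves gluings because the gluing is the least upper bound.  Hence the
   coefficient of s (x) t in Delta(std(G)) is the number of pairs (I, J) with
   std(I) = s, std(J) = t and gluing G.  Summing over the G subordinate to L
   counts all pairs (I, J) subordinate to L, since I and J determine G. *)
From HB Require Import structures.
From mathcomp Require Import all_boot all_order all_algebra finmap zify.
From mathcomp Require Import freeg.
From mathcomp Require Import boolp classical_sets functions cardinality fsbigop.
Require Import Defs.

Set Implicit Arguments.
Unset Strict Implicit.
Unset Printing Implicit Defensive.

Import GRing.Theory.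

Local Open Scope fset_scope.
Local Open Scope ring_scope.

(** * Blocks and the subordination order *)

Lemma block_nitv (I : IP) E : E \in blocks I -> is_nitv E.
Proof. by have /is_ipP[+ _ _] := valP I; apply. Qed.

Lemma block_neq0 (I : IP) E : E \in blocks I -> exists x, x \in E.
Proof. by move=> /block_nitv/is_nitvP[/fset0Pn]. Qed.

Lemma block_uniq (I : IP) E F x :
  E \in blocks I -> F \in blocks I -> x \in E -> x \in F -> E = F.
Proof. by have /is_ipP[_ + _] := valP I; apply. Qed.

Lemma block_no0 (I : IP) E : E \in blocks I -> 0%N \notin E.
Proof. by have /is_ipP[_ _ +] := valP I; apply. Qed.

Lemma block_ground (I : IP) E : E \in blocks I -> E `<=` ground I.
Proof. by move=> EI; apply/fsubsetP => x xE; apply/groundP; exists E. Qed.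

Lemma card_fset_image (T T' : choiceType) (h : T -> T') (A : {fset T}) (B : {fset T'}) :
  {in A &, injective h} -> h @` A = B -> #|` B| = #|` A|.
Proof. by move=> inj_h <-; rewrite card_in_imfset. Qed.

(** The second conjunct of [refines], verbatim: partitions of different ground sets become
    comparable, and folding converts one into the other. *)
Definition subord (I J : IP) : bool :=
  [forall E : blocks I, exists F : blocks J, val E `<=` val F].

Lemma subordP (I J : IP) :
  reflect (forall E, E \in blocks I -> exists2 F, F \in blocks J & E `<=` F)
          (subord I J).
Proof.
apply: (iffP forallP) => [h E EI|h E].
  by have /existsP[F EF] := h [` EI]; exists (val F) => //; exact: valP.
by have [F FJ EF] := h _ (valP E); apply/existsP; exists [` FJ].
Qed.

Lemma subord_refl I : subord I I.
Proof. by apply/subordP => E EI; exists E. Qed.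

Lemma subord_trans J I K : subord I J -> subord J K -> subord I K.
Proof.
move=> /subordP IJ /subordP JK; apply/subordP => E /IJ[F /JK[G GK FG] EF].
by exists G => //; exact: fsubset_trans FG.
Qed.

Lemma subord_ground I J : subord I J -> ground I `<=` ground J.
Proof.
move=> /subordP IJ; apply/fsubsetP => x /groundP[E /IJ[F FJ /fsubsetP EF] xE].
by apply/groundP; exists F => //; exact: EF.
Qed.

(** A block [E] of [I] is trapped in a chain [E], [F], [G] of inclusions with [G] again in [I]; as
    blocks are non-empty and disjoint, [G = E], and so [F = E]. *)
Lemma subord_anti I J : subord I J -> subord J I -> I = J.
Proof.
suff H I' J' : subord I' J' -> subord J' I' -> blocks I' `<=` blocks J'.
  by move=> IJ JI; apply/val_inj/eqP; rewrite eqEfsubset !H.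
move=> /subordP IJ /subordP JI; apply/fsubsetP => E EI.
have [F FJ EF] := IJ _ EI; have [G GI FG] := JI _ FJ.
have [x xE] := block_neq0 EI.
have GE : E = G.
  by apply: (block_uniq EI GI xE); apply: (fsubsetP FG); apply: (fsubsetP EF).
suff -> : E = F by [].
by apply/eqP; rewrite eqEfsubset EF GE FG.
Qed.

(** Cutting by cliques costs nothing here: a block of [I] is an interval inside [A], hence lies in a
    single clique of [A]. *)
Lemma subord_restr (I L : IP) A :
  ground I = A -> subord I (restr L A) = subord I L.
Proof.
move=> gI; apply/idP/idP => /subordP h; apply/subordP => E EI.
  have [F] := h _ EI; rewrite /= in_fsetD1 => /andP[_ /imfset2P[/= G GL [c _ ->]]].
  by rewrite fsubsetI => /andP[EG _]; exists G.
have [F FL EF] := h _ EI.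
have [|c cA Ec] := @cliques_coarsest A E _ (block_nitv EI).
  by rewrite -gI; exact: block_ground.
have EFc : E `<=` F `&` c by rewrite fsubsetI EF.
exists (F `&` c) => //; rewrite /= in_fsetD1; apply/andP; split.
  by have [x xE] := block_neq0 EI; apply/fset0Pn; exists x; exact: (fsubsetP EFc).
by apply/imfset2P; exists F => //; exists c.
Qed.

(** * Gluing as a least upper bound *)

Section Glue.
Variables I J : IP.
Let B := blocks I `|` blocks J.

Lemma glue_blockP X :
  reflect (exists T : B, X = (\bigcup_(F | glue_eqv T F) val F)%fset)
          (X \in glue I J).
Proof.
apply: (iffP (imfsetP _ _ _ _)) => /= [[T _ ->]|[T ->]]; by exists T.
Qed.

Let mem_class (T : B) x :
  reflect (exists2 F : B, glue_eqv T F & x \in val F)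
          (x \in (\bigcup_(F | glue_eqv T F) val F)%fset).
Proof.
apply: (iffP (bigfcupP _ _ _ _)) => [[F /andP[_ TF] xF]|[F TF xF]]; exists F => //.
by rewrite mem_index_enum.
Qed.

Let nitv_mem (F : B) : is_nitv (val F).
Proof. by have := valP F; rewrite inE => /orP[] /block_nitv. Qed.

(** A chain of meeting intervals cannot jump over a point. With [w] common to the first two blocks,
    [z] lies either between [x] and [w], hence in [E], or between [w] and [y], where induction
    applies. Both orders of the endpoints are allowed because the chain may turn back. *)
Let between (E F : B) : glue_eqv E F -> forall x y z, x \in val E -> y \in val F ->
  ((x <= z <= y) || (y <= z <= x))%N -> exists2 H : B, glue_eqv E H & z \in val H.
Proof.
move=> /connectP[p pE ->] {F}.
elim: p E pE => [|F p IH] E /= => [_|/andP[/[dup] EF /fset0Pn[w] + pF]] x y z xE yF xzy.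
  have /is_nitvP[_ cE] := nitv_mem E.
  exists E; first exact: connect0.
  by case/orP: xzy => xzy; [exact: (cE x y)|exact: (cE y x)].
rewrite inE => /andP[wE wF].
have /is_nitvP[_ cE] := nitv_mem E.
have [/orP zE|nz] := boolP ((x <= z <= w) || (w <= z <= x))%N.
  exists E; first exact: connect0.
  by case: zE => zE; [exact: (cE x w)|exact: (cE w x)].
have [|H FH zH] := IH _ pF w y z wF yF; first by move: xzy nz; lia.
by exists H => //; apply: connect_trans FH; exact: connect1.
Qed.

Lemma glue_is_ip : is_ip (glue I J).
Proof.
have [eqv sub _] := glue_eqvP B; have /equivalence_relP[rr lr] := eqv.
apply/is_ipP; split.
- move=> _ /glue_blockP[T ->]; apply/is_nitvP; split.
    have /is_nitvP[/fset0Pn[x xT] _] := nitv_mem T.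
    by apply/fset0Pn; exists x; apply/mem_class; exists T.
  move=> x y z /mem_class[E TE xE] /mem_class[F TF yF] xzy.
  have EF : glue_eqv E F by rewrite -(lr _ _ TE).
  have [|H EH zH] := between EF xE yF (z := z); first by rewrite xzy.
  by apply/mem_class; exists H => //; rewrite (lr _ _ TE).
- move=> _ _ x /glue_blockP[T ->] /glue_blockP[U ->] /mem_class[E TE xE] /mem_class[F UF xF].
  have EF : glue_eqv E F by apply: sub; apply/fset0Pn; exists x; rewrite inE xE.
  have TU : glue_eqv T =1 glue_eqv U.
    by move=> G; rewrite (lr _ _ TE) (lr _ _ EF) (lr _ _ UF).
  exact: eq_bigl.
- move=> _ /glue_blockP[T ->]; apply/mem_class => -[F _].
  by have := valP F; rewrite inE => /orP[] /block_no0/negbTE ->.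
Qed.

Definition glue_ip : IP := MkIP glue_is_ip.

Let subord_glue E : E \in B -> exists2 F, F \in glue I J & E `<=` F.
Proof.
move=> EB; exists (\bigcup_(F | glue_eqv [` EB] F) val F)%fset.
  by apply/glue_blockP; exists [` EB].
by apply/fsubsetP => x xE; apply/mem_class; exists [` EB] => //; exact: connect0.
Qed.

Lemma subord_gluel : subord I glue_ip.
Proof. by apply/subordP => E EI; apply: subord_glue; rewrite inE EI. Qed.

Lemma subord_gluer : subord J glue_ip.
Proof. by apply/subordP => E EI; apply: subord_glue; rewrite inE EI orbT. Qed.

(** Let [D] be the block of [G] around [T]. Being contained in [D] passes from a block to any block
    meeting it, since the block of [G] around the latter shares a point with [D]; so it holds on the
    whole class of [T]. *)
Lemma glue_subord G : subord I G -> subord J G -> subord glue_ip G.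
Proof.
move=> /subordP IG /subordP JG; apply/subordP => _ /glue_blockP[T ->].
have BG (E : B) : exists2 F, F \in blocks G & val E `<=` F.
  by have := valP E; rewrite inE => /orP[/IG|/JG].
have [D DG TD] := BG T; exists D => //.
pose a := [pred E : B | val E `<=` D].
have sym : connect_sym (@meets B).
  by apply: sym_connect_sym => E F; rewrite /meets /= fsetIC.
have cl : closed (@meets B) a.
  apply: intro_closed => // E F /fset0Pn[x]; rewrite inE => /andP[xE xF] ED.
  rewrite !inE in ED *; have [D' D'G FD'] := BG F.
  rewrite (block_uniq DG D'G (fsubsetP ED _ xE)) //; exact: (fsubsetP FD').
apply/fsubsetP => x /mem_class[F TF xF].
have : F \in a by rewrite -(closed_connect cl TF).
by move=> /fsubsetP; apply.
Qed.

Lemma ground_glue : ground glue_ip = ground I `|` ground J.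
Proof.
apply/eqP; rewrite eqEfsubset fsubUset !subord_ground ?subord_gluel ?subord_gluer //.
rewrite !andbT; apply/fsubsetP => x /groundP[_ /glue_blockP[T ->] /mem_class[F _ xF]].
have := valP F; rewrite !inE.
by case/orP=> /block_ground/fsubsetP/(_ _ xF) -> //; rewrite orbT.
Qed.

End Glue.

(* [G] is the gluing of [I] and [J] iff it is their least upper bound, and it
   is enough to compare it with the upper bounds below [G]. *)
Lemma glueP (I J G : IP) :
  reflect [/\ subord I G, subord J G & forall H, subord H G -> subord I H ->
             subord J H -> H = G]
          (glue I J == blocks G).
Proof.
apply: (iffP eqP) => [gG|[IG JG minG]].
  have <- : glue_ip I J = G by exact: val_inj.
  split; [exact: subord_gluel|exact: subord_gluer|].
  by move=> H HG IH JH; apply: subord_anti => //; exact: glue_subord.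
rewrite -(minG (glue_ip I J)) //.
- exact: glue_subord.
- exact: subord_gluel.
- exact: subord_gluer.
Qed.

(** * Transport along ranks in a larger set *)

Definition push_blocks (A : {fset nat}) (I : IP) : {fset {fset nat}} :=
  [fset rank A @` (E : {fset nat}) | E in blocks I].

(** For convexity: a value between the ranks of two points of a block is itself the rank of a point
    of [A], and monotonicity puts that point between the two, hence in the block. *)
Lemma push_is_ip A (I : IP) : ground I `<=` A -> is_ip (push_blocks A I).
Proof.
move=> /fsubsetP IA.
have sub E : E \in blocks I -> {subset E <= A}.
  by move=> EI x xE; apply/IA/groundP; exists E.
have rg x : x \in A -> rank A x \in nitv 1 #|` A|.
  by move=> xI; rewrite -rank_image; apply/imfsetP; exists x.
apply/is_ipP; split.
- move=> _ /imfsetP[/= E EI ->]; have /is_nitvP[/fset0Pn[x xE] cE] := block_nitv EI.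
  apply/is_nitvP; split.
    by apply/fset0Pn; exists (rank A x); apply/imfsetP; exists x.
  move=> _ _ z /imfsetP[/= a aE ->] /imfsetP[/= b bE ->] abz.
  have aA := sub _ EI _ aE; have bA := sub _ EI _ bE.
  have : z \in nitv 1 #|` A|.
    by move: (rg _ aA) (rg _ bA) abz; rewrite !mem_nitv; lia.
  rewrite -rank_image => /imfsetP[/= w wA zw]; apply/imfsetP; exists w => //=.
  by apply: (cE a b) => //; move: abz; rewrite zw !rank_mono.
- move=> _ _ z /imfsetP[/= E EI ->] /imfsetP[/= F FI ->].
  move=> /imfsetP[/= a aE ->] /imfsetP[/= b bF /rank_inj ab].
  have {}ab : a = b by apply: ab; [exact: sub aE | exact: sub bF].
  by rewrite (block_uniq EI FI aE) // ab.
- move=> _ /imfsetP[/= E EI ->]; apply/imfsetP => -[/= x /(sub _ EI) /rg].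
  by rewrite mem_nitv => /[swap] <-.
Qed.

(* Junk value [I] when [I] does not live on a subset of [A]. *)
Definition push (A : {fset nat}) (I : IP) : IP := insubd I (push_blocks A I).

Lemma blocks_push A I : ground I `<=` A -> blocks (push A I) = push_blocks A I.
Proof. by move=> IA; rewrite /push insubdK //; exact: push_is_ip. Qed.

Lemma std_push I : std I = push (ground I) I :> IP.
Proof. by apply: val_inj; rewrite /= blocks_push. Qed.

Lemma ground_push A I : ground I `<=` A -> ground (push A I) = rank A @` ground I.
Proof.
move=> IA; apply/fsetP => z; apply/groundP/imfsetP => /=; rewrite blocks_push //.
  move=> [_ /imfsetP[/= E EI ->] /imfsetP[/= x xE ->]].
  by exists x => //; apply/groundP; exists E.
move=> [x /groundP[E EI xE] ->]; exists (rank A @` E).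
  by apply/imfsetP; exists E.
by apply/imfsetP; exists x.
Qed.

Lemma rank_image_sub (A E F : {fset nat}) : E `<=` A -> F `<=` A ->
  (rank A @` E `<=` rank A @` F) = (E `<=` F).
Proof.
move=> /fsubsetP EA /fsubsetP FA; apply/fsubsetP/fsubsetP => EF x.
  move=> xE; have /EF/imfsetP[/= y yF] : rank A x \in rank A @` E.
    by apply/imfsetP; exists x.
  by move=> /rank_inj ->; [|exact: EA|exact: FA].
by move=> /imfsetP[/= y yE ->]; apply/imfsetP; exists y => //; exact: EF.
Qed.

Lemma push_subord A I J : ground I `<=` A -> ground J `<=` A ->
  subord (push A I) (push A J) = subord I J.
Proof.
move=> IA JA; apply/subordP/subordP; rewrite !blocks_push // => h E.
  move=> EI; have [|_ /imfsetP[/= F FJ ->] EF] := h (rank A @` E).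
    by apply/imfsetP; exists E.
  exists F => //; rewrite -(rank_image_sub (A := A)) //.
    by apply: fsubset_trans IA; exact: block_ground.
  by apply: fsubset_trans JA; exact: block_ground.
move=> /imfsetP[/= {}E EI ->]; have [F FJ EF] := h _ EI.
exists (rank A @` F); first by apply/imfsetP; exists F.
by apply: subset_imfset; exact: (fsubsetP EF).
Qed.

Lemma push_inj A I J : ground I `<=` A -> ground J `<=` A ->
  push A I = push A J -> I = J.
Proof.
move=> IA JA eqIJ; apply: subord_anti.
  by rewrite -(push_subord IA JA) eqIJ subord_refl.
by rewrite -(push_subord JA IA) eqIJ subord_refl.
Qed.

(** [rank A] maps the elements of [B] up to [x] bijectively onto the elements of its image up to
    [rank A x]. *)
Lemma rank_comp (A B : {fset nat}) x : B `<=` A -> x \in B ->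
  rank (rank A @` B) (rank A x) = rank B x.
Proof.
move=> /fsubsetP BA xB; rewrite /rank -/(rank A).
apply: (card_fset_image (h := rank A)).
  by move=> y z; rewrite !inE /= => /andP[/BA yA _] /andP[/BA zA _]; exact: rank_inj.
apply/fsetP => z; rewrite !inE /=; apply/imfsetP/andP => /=.
  move=> [y]; rewrite !inE /= => /andP[yB yx] ->; split; last by rewrite rank_mono ?BA.
  by apply/imfsetP; exists y.
move=> [/imfsetP[/= y yB ->]]; rewrite rank_mono ?BA // => yx.
by exists y; rewrite ?inE ?yB.
Qed.

Lemma stdK A I : ground I `<=` A -> std (push A I) = std I.
Proof.
move=> IA; apply: val_inj; apply: val_inj => /=; rewrite /std_blocks.
rewrite ground_push // blocks_push //.
have H (E : {fset nat}) : E \in blocks I ->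
    rank (rank A @` ground I) @` (rank A @` E) = rank (ground I) @` E.
  move=> EI; rewrite -imfset_comp; apply: eq_in_imfset => // x xE /=.
  by apply: rank_comp => //; exact: (fsubsetP (block_ground EI)).
apply/fsetP => X; apply/imfsetP/imfsetP => /= [[_ /imfsetP[/= E EI ->] ->]|[E EI ->]].
  by exists E => //; exact: H.
by exists (rank A @` E); [apply/imfsetP; exists E|rewrite H].
Qed.

Lemma std_id (s : StIP) : std s = s.
Proof.
have gs : ground s = nitv 1 #|` ground s| := eqP (valP s).
(* The elements of [[n]] up to [x] form [nitv 1 x], so ranking in [[n]] is the identity. *)
have rk x : x \in ground s -> rank (ground s) x = x.
  rewrite gs => xs; rewrite -[RHS]card_nitv1; congr #|` _|; apply/fsetP => y.
  by move: xs; rewrite !inE /= !mem_index_iota; lia.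
have H (E : {fset nat}) : E \in blocks s -> rank (ground s) @` E = E.
  move=> Es; rewrite -[RHS]imfset_id; apply: eq_in_imfset => // x xE /=.
  by apply: rk; exact: (fsubsetP (block_ground Es)).
apply: val_inj; apply: val_inj => /=; apply/fsetP => X.
apply/imfsetP/idP => /= [[E Es ->]|Xs]; first by rewrite H.
by exists X; rewrite // H.
Qed.

Lemma ground_std I : ground (std I) = nitv 1 #|` ground I|.
Proof. exact: ground_std_blocks. Qed.

(* A block of [I] lies in a block of [std K], whose preimage is an interval; so
   its own preimage is an interval even when [ground K] is not. *)
Lemma push_surj (K I : IP) : subord I (std K) ->
  exists2 I', subord I' K & push (ground K) I' = I.
Proof.
move=> /subordP IK; set A := ground K.
pose pre (E : {fset nat}) := [fset x in A | rank A x \in E].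
have pre_im (E : {fset nat}) : E \in blocks I -> rank A @` pre E = E.
  move=> EI; apply/fsetP => z; apply/imfsetP/idP => /= [[x]|zE].
    by rewrite !inE /= => /andP[_ ?] ->.
  have [_ /imfsetP[/= F FK ->] /fsubsetP/(_ _ zE)/imfsetP[/= x xF zx]] := IK _ EI.
  exists x => //; rewrite !inE /= -zx zE andbT.
  exact: (fsubsetP (block_ground FK)).
have pre_sub (E : {fset nat}) : E \in blocks I ->
    exists2 F, F \in blocks K & pre E `<=` F.
  move=> EI; have [_ /imfsetP[/= F FK ->] EF] := IK _ EI; exists F => //.
  rewrite -(rank_image_sub (A := A)) ?pre_im //; last exact: block_ground.
  by apply/fsubsetP => x; rewrite !inE => /andP[].
pose Q := [fset pre E | E in blocks I].
have ipQ : is_ip Q.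
  apply/is_ipP; split.
  - move=> _ /imfsetP[/= E EI ->]; apply/is_nitvP; split.
      have [x] := block_neq0 EI; rewrite -{1}(pre_im _ EI) => /imfsetP[/= y yE _].
      by apply/fset0Pn; exists y.
    have [F FK EF] := pre_sub _ EI; have /is_nitvP[_ cF] := block_nitv FK.
    move=> x y z xE yE xzy.
    have zA : z \in A.
      apply: (fsubsetP (block_ground FK)).
      by apply: (cF x y) => //; exact: (fsubsetP EF).
    move: xE yE; rewrite !inE /= zA => /andP[xA xE] /andP[yA yE].
    have /is_nitvP[_ cE] := block_nitv EI.
    by apply: (cE _ _ _ xE yE); rewrite !rank_mono.
  - move=> _ _ x /imfsetP[/= E EI ->] /imfsetP[/= F FI ->].
    rewrite !inE /= => /andP[_ xE] /andP[_ xF].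
    by rewrite (block_uniq EI FI xE xF).
  - move=> _ /imfsetP[/= E EI ->]; rewrite !inE /= negb_and; apply/orP; left.
    by apply/groundP => -[F /block_no0/negbTE ->].
have QK : subord (MkIP ipQ) K.
  by apply/subordP => _ /imfsetP[/= E EI ->]; exact: pre_sub.
exists (MkIP ipQ) => //; apply: val_inj => /=.
rewrite blocks_push; last exact: subord_ground.
apply/fsetP => X; apply/imfsetP/idP => /= [[_ /imfsetP[/= E EI ->] ->]|XI].
  by rewrite pre_im.
by exists (pre X); [apply/imfsetP; exists X|rewrite pre_im].
Qed.


(** * Sums over subordinate partitions *)

Definition IPs (A : {fset nat}) : {fset IP} :=
  (\bigcup_(B <- fpowerset A) IPon B)%fset.

Lemma mem_IPs A I : (I \in IPs A) = (ground I `<=` A).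
Proof.
apply/bigfcupP/idP => [[B]|IA].
  by rewrite andbT fpowersetE mem_IPon => BA /eqP ->.
by exists (ground I); rewrite ?mem_IPon // fpowersetE IA.
Qed.

Definition below (K : IP) : {fset IP} := [fset I in IPs (ground K) | subord I K].

Lemma mem_below K I : (I \in below K) = subord I K.
Proof.
by rewrite !inE /= mem_IPs andbC; case: (boolP (subord I K)) => //= /subord_ground.
Qed.

Lemma below_sub (K L : IP) : subord K L -> below K `<=` below L.
Proof.
move=> KL; apply/fsubsetP => I; rewrite !mem_below => /subord_trans; exact.
Qed.

Lemma push_below (K : IP) : below (std K) = push (ground K) @` below K.
Proof.
apply/fsetP => I; rewrite mem_below; apply/idP/imfsetP => [/push_surj[J JK <-]|].
  by exists J => //; rewrite mem_below.
move=> [J]; rewrite mem_below => JK ->; rewrite std_push push_subord //.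
exact: subord_ground.
Qed.

Lemma sum_below_std (K : IP) (V : nmodType) (F : IP -> V) :
  \sum_(I <- below (std K)) F I = \sum_(I <- below K) F (push (ground K) I).
Proof.
rewrite push_below big_imfset // => I J /=; rewrite !mem_below => IK JK.
by apply: push_inj; exact: subord_ground.
Qed.

(** [glueP] tests only upper bounds below the candidate, and these are exactly what [push_surj]
    pulls back to partitions subordinate to [K]. *)
Lemma glue_push (K I J : IP) : subord I K -> subord J K ->
  (glue (push (ground K) I) (push (ground K) J) == blocks (std K))
  = (glue I J == blocks K).
Proof.
move=> IK JK.
have [gI gJ] := (subord_ground IK, subord_ground JK).
apply/glueP/glueP => -[_ _ minK].
  split=> // H HK IH JH; have gH := subord_ground HK.
  apply: (push_inj gH (fsubset_refl _)); rewrite -std_push.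
  by apply: minK; rewrite ?push_subord // std_push push_subord.
split; rewrite ?std_push ?push_subord // -?std_push => H /push_surj[H' H'K <-].
have gH := subord_ground H'K; rewrite !push_subord // => IH JH.
by rewrite (minK H') // -std_push.
Qed.

(** * Signature and coproduct as counts of partitions *)

Lemma IPC_basis_below (L s : StIP) :
  (IPC_basis L s)%:R = \sum_(I <- below L) (std I == s)%:R :> rat.
Proof.
transitivity (#|` [fset I in below L | std I == s]|%:R : rat); last first.
  rewrite -sum1_size natr_sum big_fset big_mkcond /=.
  by apply: eq_bigr => I _; case: (std I == s).
(* The bijection sends a partition [I] to the subset [ground I] of [ground L]. *)
congr _%:R; apply: (card_fset_image (h := ground)).
  move=> I J; rewrite in_fset /= inE => /andP[_ /eqP Is].
  rewrite in_fset /= inE => /andP[_ /eqP Js] gIJ.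
  apply: (push_inj (A := ground I)); rewrite -?gIJ //.
  by rewrite {2}gIJ -!std_push Is Js.
apply/fsetP => A; apply/imfsetP/idP => [[I]|].
  rewrite /= in_fset /= inE mem_below => /andP[IL /eqP <-] ->.
  have gI := subord_ground IL.
  have gR : ground (restr L (ground I)) = ground I by rewrite ground_restr; apply/fsetIidPl.
  have ref : refines (std I) (std (restr L (ground I))).
    rewrite /refines !ground_std gR eqxx -/(subord _ _) !std_push gR.
    by rewrite push_subord ?gR // subord_restr.
  by rewrite in_fset; apply/andP; split; [rewrite fpowersetE|exact: ref].
rewrite in_fset /= inE fpowersetE => /andP[AL /andP[/eqP gs]].
have gR : ground (restr L A) = A by rewrite ground_restr; apply/fsetIidPl.
(* The partition on [A] is obtained by pulling [s] back along the ranking of [A]. *)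
rewrite -/(subord _ _) => /push_surj[I IR pI].
have IA := subord_ground IR; rewrite gR in IA pI.
have Is : std I = s by rewrite -(stdK IA) pI std_id.
(* [I] fills [A]: both have as many points as [s]. *)
have gI : ground I = A.
  apply/eqP; rewrite eqEfcard IA /=; have := congr1 (fun B => #|` B|) gs.
  by rewrite -Is !ground_std gR !card_nitv1 => ->.
exists I; last by [].
by rewrite in_fset /= inE mem_below Is eqxx andbT -(subord_restr L gI).
Qed.

(** For standard [G] this is the coefficient of [tensor s t] in [Delta_basis G]. Allowing any [G]
    lets it be summed over [below L]. *)
Definition nglue (G : IP) (s t : StIP) : rat :=
  \sum_(I <- below G) \sum_(J <- below G)
    [&& std I == s, std J == t & glue I J == blocks G]%:R.

Lemma nglue_std G s t : nglue (std G) s t = nglue G s t.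
Proof.
rewrite /nglue sum_below_std; apply: eq_big_seq => I; rewrite mem_below => IG.
rewrite sum_below_std; apply: eq_big_seq => J; rewrite mem_below => JG.
by rewrite glue_push // !stdK ?subord_ground.
Qed.

Lemma big_seq_pred1 (T : eqType) (V : nmodType) (r : seq T) x (F : T -> V) :
  uniq r -> x \in r -> \sum_(i <- r | i == x) F i = F x.
Proof.
by move=> ur xr; rewrite -big_filter filter_pred1_uniq // big_seq1.
Qed.

(** Each partition belongs to [IPon A] for exactly one [A], its ground set, so the double sum
    flattens. *)
Lemma sum_IPon (X : {fset nat}) (P : pred {fset nat}) (V : nmodType)
    (F : {fset nat} -> IP -> V) :
  \sum_(A <- fpowerset X | P A) \sum_(I <- IPon A) F A I
  = \sum_(I <- IPs X | P (ground I)) F (ground I) I.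
Proof.
rewrite big_seq_cond.
transitivity (\sum_(A <- fpowerset X | (A \in fpowerset X) && P A)
    \sum_(I <- IPs X | ground I == A) F A I).
  apply: eq_bigr => A /andP[]; rewrite fpowersetE => AX _.
  rewrite [RHS]big_fset_condE; apply: eq_fbigl => I.
  by rewrite mem_IPon !inE /= mem_IPs andbC; case: eqP => // ->.
rewrite (exchange_big_dep (fun I => P (ground I))) /=; last first.
  by move=> A I /andP[_ PA] /eqP ->.
rewrite big_seq_cond [RHS]big_seq_cond.
apply: eq_bigr => I /andP[]; rewrite mem_IPs => IX PI.
rewrite -[RHS](@big_seq_pred1 _ _ (fpowerset X) (ground I) (F ^~ I)) ?fset_uniq ?fpowersetE //.
apply: eq_bigl => A; rewrite [ground I == A]eq_sym.
by case: eqP => [->|]; rewrite ?andbF // PI fpowersetE IX.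
Qed.

(** If [I] and [J] glue to [g], both are subordinate to [g] and their ground sets cover that of [g];
    so the two sums, with different ranges, have the same nonzero terms. *)
Lemma coeff_Delta (g s t : StIP) : coeff (s, t) (Delta_basis g) = nglue g s t.
Proof.
pose c I J : rat := [&& std I == s, std J == t & glue I J == blocks g]%:R.
(* Each sum over subsets is moved next to the sum over partitions on them, ready for [sum_IPon]. *)
transitivity (\sum_(A <- fpowerset (ground g)) \sum_(I <- IPon A)
  \sum_(A' <- fpowerset (ground g) | A `|` A' == ground g) \sum_(J <- IPon A') c I J).
  rewrite /Delta_basis raddf_sum; apply: eq_bigr => A _.
  rewrite raddf_sum [RHS]exchange_big; apply: eq_bigr => A' _.
  rewrite raddf_sum; apply: eq_bigr => I _.
  rewrite raddf_sum [LHS]big_mkcond; apply: eq_bigr => J _.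
  rewrite /= /tensor coeffU mul1r /c xpair_eqE.
  by case: (glue I J == blocks g); rewrite ?andbT // !andbF.
rewrite sum_IPon.
have belowS : below g `<=` IPs (ground g).
  by apply/fsubsetP => I; rewrite mem_below mem_IPs; exact: subord_ground.
rewrite /nglue [RHS](big_fset_incl _ belowS); last first.
  move=> I _; rewrite mem_below => nI; apply: big1 => J _.
  by case: glueP => [[/negPn]|]; rewrite ?nI // !andbF.
apply: eq_bigr => I _; rewrite sum_IPon [RHS](big_fset_incl _ belowS); last first.
  move=> J _; rewrite mem_below => nJ.
  by case: glueP => [[_ /negPn]|]; rewrite ?nJ // !andbF.
rewrite big_mkcond; apply: eq_bigr => J _.
case: ifPn => // nIJ; rewrite /c.
case: (glue I J =P blocks g) => [gl|]; last by rewrite !andbF.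
by rewrite -ground_glue (_ : glue_ip I J = g) ?eqxx // in nIJ; exact: val_inj.
Qed.

(** Widening the ranges from [below G] to [below L] adds only zero terms. After exchanging sums,
    each pair [(I, J)] meets exactly one [G], its gluing, which is below [L] as a least upper
    bound. *)
Lemma nglue_sum (L s t : StIP) :
  \sum_(G <- below L) nglue G s t = (IPC_basis L s)%:R * (IPC_basis L t)%:R.
Proof.
have widen (G : IP) : G \in below L -> nglue G s t =
    \sum_(I <- below L) \sum_(J <- below L)
      [&& std I == s, std J == t & glue I J == blocks G]%:R.
  rewrite mem_below => /below_sub GL; rewrite /nglue (big_fset_incl _ GL); last first.
    move=> I _; rewrite mem_below => nI; apply: big1 => J _.
    by case: glueP => [[/negPn]|]; rewrite ?nI // !andbF.
  apply: eq_bigr => I _; rewrite (big_fset_incl _ GL) // => J _.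
  rewrite mem_below => nJ.
  by case: glueP => [[_ /negPn]|]; rewrite ?nJ // !andbF.
rewrite (eq_big_seq _ widen) !IPC_basis_below big_distrlr exchange_big /=.
apply: eq_big_seq => I; rewrite mem_below => IL; rewrite exchange_big /=.
apply: eq_big_seq => J; rewrite mem_below => JL.
rewrite -natrM mulnb.
transitivity (\sum_(G <- below L | G == glue_ip I J) ((std I == s) && (std J == t))%:R : rat).
  rewrite [RHS]big_mkcond; apply: eq_bigr => G _.
  (* Equality on [IP] is decided on blocks, so only symmetry is at stake. *)
  rewrite (_ : (glue I J == blocks G) = (G == glue_ip I J)); last by rewrite eq_sym.
  by case: (G == _); rewrite ?andbT ?andbF.
by rewrite big_seq_pred1 // mem_below glue_subord.
Qed.

(** * Linear extension and multiplicativity *)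

HB.instance Definition _ (K : choiceType) (V : lmodType rat) (f : K -> V) :=
  GRing.isLinear.Build rat {freeg K / rat} V *:%R (fglift f) (fglift_linear f).

HB.instance Definition _ (L : StIP) :=
  GRing.isLinear.Build rat H_int rat^o *:%R (IPC L) (IPC_linear L).

Lemma fglift_sum (K : choiceType) (V : lmodType rat) (f : K -> V) x :
  fglift f x = \sum_(k <- dom x) coeff k x *: f k.
Proof.
rewrite -[in LHS](freeg_sumE x) linear_sum /=.
by apply: eq_bigr => k _; rewrite liftU.
Qed.

(** The partitions [G] below [L] are grouped by [g = std G]: [IPC_basis L g] is the size of a group,
    and [nglue] is constant on it by [nglue_std]. *)
Lemma IPC_spade_basis (L s t : StIP) :
  IPC L (spade_basis s t) = (IPC_basis L s)%:R * (IPC_basis L t)%:R.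
Proof.
pose S := fset_set [set g : StIP | pairing (tensor s t) (Delta_basis g) != 0].
(* The support is enlarged so that every [G] below [L] finds [std G] in the range, even where the
   coefficient vanishes. *)
pose T := S `|` [fset std G | G in below L].
rewrite /spade_basis (fsbigTE T) => [|g gT]; last first.
  suff -> : pairing (tensor s t) (Delta_basis g) = 0 by rewrite scale0r.
  apply: contraNeq gT => nz; rewrite inE in_fset_set; last exact: spade_finite.
  by rewrite mem_set.
transitivity (\sum_(g <- T) \sum_(G <- below L | g == std G) nglue g s t : rat).
  rewrite linear_sum; apply: eq_bigr => g _.
  rewrite pairing_tensor coeff_Delta linearZ /= IPC_basisE IPC_basis_below.
  (* Scaling in [rat^o] is multiplication. *)
  rewrite -[LHS]/(_ * _) mulr_sumr [RHS]big_mkcond; apply: eq_bigr => G _.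
  by rewrite eq_sym; case: eqP; rewrite ?mulr1 ?mulr0.
rewrite (exchange_big_dep xpredT) //= -nglue_sum; apply: eq_big_seq => G GL.
rewrite big_seq_pred1 ?nglue_std ?fset_uniq //; apply/fsetUP; right.
by apply/imfsetP; exists G.
Qed.

Theorem theorem3p37 (N : nat) (L : StIP) (hL : L \in StIPn N) :
  (forall s t : StIP,
     IPC L << s >> * IPC L << t >> = IPC L (spade << s >> << t >>))
  /\ is_character (IPC L).
Proof.
split=> [s t|]; first by rewrite spade_basisE IPC_spade_basis !IPC_basisE.
split=> [|x y]; first exact: IPC_linear.
(* Expanding [x], then [y], in the basis reduces the claim to [IPC_spade_basis]. *)
rewrite /spade fglift_sum linear_sum [IPC L x]fglift_sum mulr_suml.
apply: eq_bigr => s _; rewrite linearZ -[RHS]mulrA; congr (_ * _).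
rewrite fglift_sum linear_sum [IPC L y]fglift_sum mulr_sumr.
by apply: eq_bigr => t _; rewrite linearZ [RHS]mulrCA /= IPC_spade_basis.
Qed.
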